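(* Let $m\ne n$, let $1\le k\le\min(m,n)$, and let $$A=\begin{bmatrix}\widehat\Sigma & E^{T}\\ F & A_2\end{bmatrix}\in\mathbb{R}^{m\times n},$$ where $\widehat\Sigma=\mathrm{diag}(\theta_1,\ldots,\theta_k)\in\mathbb{R}^{k\times k}$ with $\theta_1,\dots,\theta_k\ge0$, $E=[E_1,E_2,\ldots,E_k]\in\mathbb{R}^{(n-k)\times k}$ has columns $E_1,\dots,E_k$, $F=[F_1,F_2,\ldots,F_k]\in\mathbb{R}^{(m-k)\times k}$ has columns $F_1,\dots,F_k$, and $A_2\in\mathbb{R}^{(m-k)\times(n-k)}$. For $i\in\{1,2,\ldots,k\}$, suppose that $$\delta_i=\min\Big(|\theta_i|,\ \min_j|\theta_i-\sigma_j(A_2)|\Big)-\sqrt{\frac{\|E_i\|_2^2+\|F_i\|_2^2}{2}}>0,$$ $$\delta_{i,j}=|\theta_i-\theta_j|-\sqrt{\frac{\|E_i\|_2^2+\|F_i\|_2^2}{2}}>0\quad\text{for all }1\le j\le k,\ j\ne i,$$ $$\delta'_{i,j}=|\theta_i+\theta_j|-\sqrt{\frac{\|E_i\|_2^2+\|F_i\|_2^2}{2}}>0\quad\text{for all }1\le j\le k,$$ and that $$d_i=\frac{1}{\delta_i-\displaystyle\sum_{1\le j\le k,\ j\ne i}\frac{\|E_j\|_2^2+\|F_j\|_2^2}{2\,\delta_{i,j}}-\sum_{1\le j\le k}\frac{\|E_j\|_2^2+\|F_j\|_2^2}{2\,\delta'_{i,j}}}>0.$$ Then there exists a singular value $\sigma_i$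 of $A$ such that $$|\sigma_i-\theta_i|\le d_i\,\frac{\|E_i\|_2^2+\|F_i\|_2^2}{2}.$$
   Context: $\|\cdot\|_2$ denotes the Euclidean norm of a vector. $\sigma_j(A_2)$, $j=1,\dots,\min(m,n)-k$, are the singular values of $A_2$ (an empty minimum is $+\infty$). The $\theta_i$ are approximate singular values of $A$ and come from the singular value decomposition of a projected matrix. *)

(* Defs.v *)
From mathcomp Require Import all_boot all_order all_algebra.
From mathcomp Require complex.
From mathcomp Require Import ring.
From mathcomp Require Import boolp reals.
Set Implicit Arguments.
Unset Strict Implicit.
Unset Printing Implicit Defensive.
Import Order.TTheory GRing.Theory Num.Theory.
Local Open Scope ring_scope.

Definition norm2 (R : realType) (p : nat) (v : 'cV[R]_p) : R :=
  Num.sqrt (\sum_i v i 0 ^+ 2).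

Definition is_svd (R : realType) (p q : nat) (A : 'M[R]_(p, q))
    (U : 'M[R]_p) (S : 'M[R]_(p, q)) (V : 'M[R]_q) : Prop :=
  [/\ U^T *m U = 1%:M, V^T *m V = 1%:M, A = U *m S *m V^T,
      forall (i : 'I_p) (j : 'I_q), i != j :> nat -> S i j = 0 &
      forall (i : 'I_p) (j : 'I_q), i == j :> nat -> 0 <= S i j].

Section SvdExists.
Import complex.
Variable R : realType.

(* Auxiliary facts for [svd_exists], which [sing_val] needs to be total. *)

Lemma sym_eigen (n : nat) (S : 'M[R]_n) :
  S^T = S -> S != 0 ->
  exists2 a : R, a != 0 & exists2 v : 'rV[R]_n, v != 0 & v *m S = a *: v.
Proof.
move=> symS S0; pose f : {rmorphism R -> complex R} := real_complex R.
pose Sc := map_mx f S.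
have hSc : Sc \is hermsymmx.
  apply: realsym_hermsym.
    by apply/is_hermitianmxP; rewrite expr0 scale1r map_mx_id // /Sc map_trmx symS.
  by apply/mxOverP => i j; rewrite mxE; apply/complex_realP; exists (S i j).
have Sc0 : Sc != 0 by rewrite map_mx_eq0.
have /orthomx_spectralP ScE := hermitian_normalmx hSc.
have Pu : spectralmx Sc \in unitmx := spectral_unit Sc.
have Dr := hermitian_spectral_diag_real hSc.
move: ScE Pu Dr.
set P := spectralmx Sc; set D := spectral_diag Sc => ScE Pu /mxOverP Dr.
have [j Dj] : exists j, D 0 j != 0.
  apply/existsP; apply: contraNT Sc0 => /existsPn D0.
  suff D00 : D = 0 by rewrite ScE D00 raddf0 mulmx0 mul0mx.
  by apply/rowP => j; rewrite !mxE; apply/eqP; rewrite -[_ == _]negbK D0.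
have /complex_realP [a Da] := Dr 0 j.
have a0 : a != 0 by apply: contraNneq Dj => a0; rewrite Da a0.
exists a => //.
have /eigenvalueP [v vS v0] : eigenvalue S a.
  rewrite eigenvalue_root_char -(fmorph_root f) map_char_poly -/Sc.
  rewrite -eigenvalue_root_char; apply/eigenvalueP; exists (row j P).
    rewrite -row_mul {1}ScE !mulmxA mulmxV // mul1mx.
    by rewrite row_mul row_diag_mx -scalemxAl -rowE Da.
  apply: contraTneq Pu => Pj; rewrite -row_free_unit -kermx_eq0.
  apply/negP => /eqP kP; have : (delta_mx 0 j : 'rV_n) *m P = 0 by rewrite -rowE.
  move=> /sub_kermxP; rewrite kP submx0 => /eqP /rowP /(_ j).
  by rewrite !mxE !eqxx => /eqP; rewrite oner_eq0.
by exists v.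
Qed.

Lemma sqnorm_ge0 n (x : 'cV[R]_n) : 0 <= (x^T *m x) 0 0.
Proof. by rewrite mxE sumr_ge0 // => i _; rewrite !mxE -expr2 sqr_ge0. Qed.

Lemma sqnorm_eq0 n (x : 'cV[R]_n) : ((x^T *m x) 0 0 == 0) = (x == 0).
Proof.
apply/eqP/eqP => [|->]; last by rewrite mulmx0 mxE.
rewrite mxE => /eqP; rewrite psumr_eq0 => [/allP x0|i _]; last first.
  by rewrite !mxE -expr2 sqr_ge0.
apply/colP => i; have := x0 i (mem_index_enum _).
by rewrite !mxE -expr2 sqrf_eq0 => /eqP.
Qed.

Lemma householder n (x : 'cV[R]_n.+1) : x^T *m x = 1%:M ->
  exists2 H : 'M[R]_n.+1, H^T *m H = 1%:M & H *m delta_mx 0 0 = x.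
Proof.
move=> x1; pose e : 'cV[R]_n.+1 := delta_mx 0 0; pose w := e - x.
have ee : e^T *m e = 1%:M.
  by rewrite trmx_delta mul_delta_mx; apply/matrixP => i j; rewrite !ord1 !mxE.
have [w0|w0] := eqVneq w 0.
  exists 1%:M; first by rewrite trmx1 mulmx1.
  by rewrite mul1mx; apply/eqP; rewrite -subr_eq0 -/e -/w w0.
pose c := (w^T *m w) 0 0.
have wc : w^T *m w = c%:M by rewrite [LHS]mx11_scalar.
have c0 : c != 0 by rewrite sqnorm_eq0.
have xe : x^T *m e = e^T *m x.
  by rewrite [LHS]mx11_scalar [RHS]mx11_scalar -[e^T *m x]trmxK trmx_mul trmxK [in RHS]mxE.
have we : w^T *m e = (c / 2)%:M.
  have : w^T *m w = (w^T *m e) *+ 2.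
    have -> : w^T = e^T - x^T by rewrite /w linearB.
    by rewrite /w mulmxBr !mulmxBl ee x1 xe mulr2n opprB.
  rewrite wc [w^T *m e]mx11_scalar; set t := (w^T *m e) 0 0.
  move=> /matrixP /(_ 0 0); rewrite mulr2n !mxE eqxx !mulr1n => ->.
  by rewrite -mulr2n -[t *+ 2]mulr_natr mulfK // pnatr_eq0.
pose H := 1%:M - (2 / c) *: (w *m w^T).
have HT : H^T = H by rewrite /H linearB linearZ /= trmx_mul trmxK trmx1.
exists H.
  have XX : (2 / c *: (w *m w^T)) *m (2 / c *: (w *m w^T))
          = 2 / c *: (w *m w^T) + 2 / c *: (w *m w^T).
    rewrite -scalemxAl -scalemxAr mulmxA -(mulmxA w) wc mul_mx_scalar -scalemxAl.
    rewrite !scalerA -scalerDl; congr (_ *: _).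
    by field.
  rewrite HT /H; move: (2 / c *: _) XX => X XX.
  rewrite mulmxBr mulmx1 mulmxBl mul1mx XX.
  have -> : X - (X + X) = - X by rewrite opprD addrA subrr add0r.
  by rewrite opprK subrK.
rewrite /H mulmxBl mul1mx -scalemxAl -mulmxA we mul_mx_scalar scalerA.
by rewrite [_ / c]mulrC mulrACA mulVf // mulfV ?pnatr_eq0 // mulr1 scale1r /w subKr.
Qed.

Lemma svd_exists (p q : nat) (A : 'M[R]_(p, q)) :
  exists USV : 'M[R]_p * 'M[R]_(p, q) * 'M[R]_q,
    is_svd A USV.1.1 USV.1.2 USV.2.
Proof.
elim: q p A => [|q IH] [|p] A.
- exists (1%:M, 0, 1%:M); split; rewrite ?trmx1 ?mulmx1 //; try by move=> ? [].
  by apply/matrixP => ? [].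
- exists (1%:M, 0, 1%:M); split; rewrite ?trmx1 ?mulmx1 //; try by move=> ? [].
  by apply/matrixP => ? [].
- exists (1%:M, 0, 1%:M); split; rewrite ?trmx1 ?mulmx1 //; try by case.
  by apply/matrixP => [[]].
have [->|A0] := eqVneq A 0.
  exists (1%:M, 0, 1%:M); split; rewrite ?trmx1 ?mulmx1 ?mulmx0 //.
    by move=> i j; rewrite mxE.
  by move=> i j; rewrite mxE.
have [||a a0 [v v0 vS]] := @sym_eigen _ (A^T *m A).
- by rewrite trmx_mul trmxK.
- apply: contraNneq A0 => S0; apply/eqP/matrixP => i j.
  have /eqP : ((col j A)^T *m col j A) 0 0 = 0.
    have <- : (A^T *m A) j j = 0 by rewrite S0 mxE.
    by rewrite !mxE; apply: eq_bigr => k _; rewrite !mxE.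
  by rewrite sqnorm_eq0 => /eqP /colP /(_ i); rewrite !mxE.
pose c := (v *m v^T) 0 0.
have c_gt0 : 0 < c.
  have := sqnorm_ge0 v^T; have := sqnorm_eq0 v^T.
  rewrite trmxK -/c trmx_eq0 (negPf v0) => /negbT c0 c_ge0.
  by rewrite lt0r c0.
pose y := (Num.sqrt c)^-1 *: v^T.
have yT : y^T = (Num.sqrt c)^-1 *: v by rewrite /y linearZ /= trmxK.
have yy : y^T *m y = 1%:M.
  rewrite yT /y -scalemxAl -scalemxAr scalerA [v *m _]mx11_scalar.
  rewrite -/c scale_scalar_mx -invfM -expr2 sqr_sqrtr ?ltW // mulVf //.
  by rewrite gt_eqF.
have yS : y^T *m (A^T *m A) = a *: y^T.
  by rewrite yT -scalemxAl vS scalerA mulrC -scalerA.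
have aE : (A *m y)^T *m (A *m y) = a%:M.
  by rewrite trmx_mul -mulmxA [A^T *m _]mulmxA mulmxA yS -scalemxAl yy
             scale_scalar_mx mulr1.
have a_gt0 : 0 < a.
  rewrite lt0r a0; have := sqnorm_ge0 (A *m y).
  by rewrite aE mxE eqxx mulr1n.
pose s := Num.sqrt a.
have s_gt0 : 0 < s by rewrite sqrtr_gt0.
have sN0 : s != 0 by rewrite gt_eqF.
have ss : s * s = a by rewrite -expr2 sqr_sqrtr ?ltW.
pose x := s^-1 *: (A *m y).
have xT : x^T = s^-1 *: (A *m y)^T by rewrite /x linearZ.
have xx : x^T *m x = 1%:M.
  rewrite xT /x -scalemxAl -scalemxAr scalerA aE scale_scalar_mx.
  by rewrite -invfM ss mulVf.
have [Hu Hu1 Hux] := householder xx; have [Hv Hv1 Hvy] := householder yy.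
pose B := Hu^T *m A *m Hv.
have AE : A = Hu *m B *m Hv^T.
  by rewrite /B !mulmxA (mulmx1C Hu1) mul1mx -mulmxA (mulmx1C Hv1) mulmx1.
have colB : B *m delta_mx 0 0 = s *: (delta_mx 0 0 : 'cV_p.+1).
  rewrite /B -mulmxA Hvy -mulmxA.
  have -> : A *m y = s *: x by rewrite /x scalerA mulfV // scale1r.
  by rewrite -scalemxAr -Hux mulmxA Hu1 mul1mx.
have rowB : delta_mx 0 0 *m B = s *: (delta_mx 0 0 : 'rV_q.+1).
  have -> : delta_mx 0 0 = (delta_mx 0 0 : 'cV[R]_p.+1)^T by rewrite trmx_delta.
  rewrite /B !mulmxA -trmx_mul Hux xT -!scalemxAl trmx_mul -!mulmxA.
  rewrite [A^T *m _]mulmxA mulmxA yS -scalemxAl scalerA -ss mulKf //.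
  by rewrite -Hvy trmx_mul -mulmxA Hv1 mulmx1 trmx_delta.
clearbody B.
have B0j (i : 'I_p.+1) (j : 'I_q.+1) : i = 0%N :> nat -> B i j = s * (j == 0%N :> nat)%:R.
  move=> i0; have -> : i = 0 by apply: val_inj.
  by move/rowP: rowB => /(_ j); rewrite -rowE !mxE eqxx.
have Bi0 (i : 'I_p.+1) (j : 'I_q.+1) : j = 0%N :> nat -> B i j = s * (i == 0%N :> nat)%:R.
  move=> j0; have -> : j = 0 by apply: val_inj.
  by move/colP: colB => /(_ i); rewrite -colE !mxE eqxx andbT.
pose B' : 'M[R]_(p, q) := drsubmx (B : 'M_(1 + p, 1 + q)).
have BE : B = block_mx s%:M 0 0 B' :> 'M_(1 + p, 1 + q).
  rewrite -[LHS](@submxK _ 1 p 1 q); congr block_mx; apply/matrixP => i j; rewrite !mxE.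
  - by rewrite !ord1 B0j //= mulr1.
  - by rewrite !ord1 B0j //= mulr0.
  - by rewrite !ord1 Bi0 //= mulr0.
have [[[U' S'] V'] /= [U1 V1 B'E S'0 S'P]] := IH _ B'.
pose U2 : 'M[R]_(1 + p) := block_mx 1%:M 0 0 U'.
pose V2 : 'M[R]_(1 + q) := block_mx 1%:M 0 0 V'.
pose S2 : 'M[R]_(1 + p, 1 + q) := block_mx s%:M 0 0 S'.
have U21 : U2^T *m U2 = 1%:M.
  by rewrite tr_block_mx mulmx_block !trmx0 !mul0mx !mulmx0 !addr0 !add0r U1
             trmx1 mulmx1 -scalar_mx_block.
have V21 : V2^T *m V2 = 1%:M.
  by rewrite tr_block_mx mulmx_block !trmx0 !mul0mx !mulmx0 !addr0 !add0r V1
             trmx1 mulmx1 -scalar_mx_block.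
have USV : block_mx s%:M 0 0 B' = U2 *m (S2 *m V2^T).
  rewrite tr_block_mx !mulmx_block !trmx0 !mul0mx !mulmx0 !addr0 !add0r.
  by rewrite !mul1mx trmx1 mulmx1 mulmxA -B'E ?mul0mx ?mulmx0.
have S20 (i : 'I_(1 + p)) (j : 'I_(1 + q)) : i != j :> nat -> S2 i j = 0.
  rewrite -(splitK i) -(splitK j); case: (split i) => i'; case: (split j) => j' /=.
  - by rewrite !ord1.
  - by rewrite /S2 block_mxEur mxE.
  - by rewrite /S2 block_mxEdl mxE.
  - by rewrite /S2 block_mxEdr /= eqn_add2l; exact: S'0.
have S2P (i : 'I_(1 + p)) (j : 'I_(1 + q)) : i == j :> nat -> 0 <= S2 i j.
  rewrite -(splitK i) -(splitK j); case: (split i) => i'; case: (split j) => j' /=.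
  - by rewrite /S2 block_mxEul !ord1 mxE eqxx /= mulr1n ltW.
  - by rewrite !ord1.
  - by rewrite !ord1.
  - by rewrite /S2 block_mxEdr /= eqn_add2l; exact: S'P.
exists ((Hu *m U2 : 'M_p.+1), (S2 : 'M_(p.+1, q.+1)), (Hv *m V2 : 'M_q.+1)); split => /=.
- by rewrite trmx_mul -mulmxA [Hu^T *m _]mulmxA Hu1 mul1mx.
- by rewrite trmx_mul -mulmxA [Hv^T *m _]mulmxA Hv1 mul1mx.
- rewrite trmx_mul {1}AE BE !mulmxA; congr (_ *m _).
  rewrite -!mulmxA; congr (_ *m _).
  exact: USV.
- exact: S20.
- exact: S2P.
Qed.

End SvdExists.

(* The minn p q diagonal entries of S in a singular value decomposition of A,
   repeated with multiplicity.  The chosen decomposition affects only the order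
   of the family, not the multiset of its values.  For p <> q the |p - q| zero
   eigenvalues of the larger of A^T A and A A^T caused by the shape of A alone
   are not singular values; the family is empty when p = 0 or q = 0. *)
Definition sing_val (R : realType) (p q : nat) (A : 'M[R]_(p, q))
    (j : 'I_(minn p q)) : R :=
  (projT1 (cid (svd_exists A))).1.2
    (widen_ord (geq_minl p q) j) (widen_ord (geq_minr p q) j).

(* Main.v *)
(* Let H be the symmetric matrix with off-diagonal blocks A and A^T.  Its
   eigenvalues are +/- the singular values of A and possibly 0, and (e_i, e_i) is
   an approximate eigenvector for theta_i with relative residual
   rho = sqrt ((|E_i|^2 + |F_i|^2) / 2).  As rho < theta_i, some singular value
   lam of A satisfies |lam - theta_i| <= rho.  In the basis of the (e_j, +/- e_j),
   completed by the last blocks, the eigenvector equation for lam lets one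
   eliminate all coordinates but those on (e_i, e_i) and on the last blocks: lam is
   at distance at least delta_{i,j}, delta'_{i,j} and delta_i from theta_j,
   - theta_j and the spectrum of the last diagonal block, so the Schur complement
   is bounded below by 1 / d_i, and lam - theta_i is quadratic in the residual. *)
Require Import Defs.
From mathcomp Require Import all_boot all_order all_algebra.
From mathcomp Require Import boolp reals.
From mathcomp Require Import ring lra.
Set Implicit Arguments.
Unset Strict Implicit.
Unset Printing Implicit Defensive.
Import Order.TTheory GRing.Theory Num.Theory.
Local Open Scope ring_scope.

(** * The Euclidean norm and its inequalities *)

Lemma norm2_ge0 (R : realType) n (x : 'cV[R]_n) : 0 <= norm2 x.
Proof. exact: sqrtr_ge0. Qed.

Lemma sqr_norm2 (R : realType) n (x : 'cV[R]_n) :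
  norm2 x ^+ 2 = \sum_i x i 0 ^+ 2.
Proof. by rewrite sqr_sqrtr // sumr_ge0 // => i _; exact: sqr_ge0. Qed.

Lemma sqr_norm2_mx (R : realType) n (x : 'cV[R]_n) :
  norm2 x ^+ 2 = (x^T *m x) 0 0.
Proof. by rewrite sqr_norm2 mxE; apply: eq_bigr => i _; rewrite mxE. Qed.

Lemma norm2_eq0 (R : realType) n (x : 'cV[R]_n) : (norm2 x == 0) = (x == 0).
Proof. by rewrite -sqrf_eq0 sqr_norm2_mx sqnorm_eq0. Qed.

Lemma norm20 (R : realType) n : norm2 (0 : 'cV[R]_n) = 0.
Proof. by apply/eqP; rewrite norm2_eq0. Qed.

Lemma norm2Z (R : realType) n a (x : 'cV[R]_n) : norm2 (a *: x) = `|a| * norm2 x.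
Proof.
rewrite -sqrtr_sqr /norm2 -sqrtrM ?sqr_ge0 // mulr_sumr; congr Num.sqrt.
by apply: eq_bigr => i _; rewrite mxE exprMn.
Qed.

Lemma norm2N (R : realType) n (x : 'cV[R]_n) : norm2 (- x) = norm2 x.
Proof. by rewrite -scaleN1r norm2Z normrN1 mul1r. Qed.

Lemma sqr_norm2_col_mx (R : realType) p q (x : 'cV[R]_p) (y : 'cV[R]_q) :
  norm2 (col_mx x y) ^+ 2 = norm2 x ^+ 2 + norm2 y ^+ 2.
Proof.
rewrite !sqr_norm2 big_split_ord.
by congr (_ + _); apply: eq_bigr => i _; rewrite ?col_mxEu ?col_mxEd.
Qed.

Lemma norm2_orthogonal (R : realType) n (U : 'M[R]_n) (x : 'cV[R]_n) :
  U^T *m U = 1%:M -> norm2 (U *m x) = norm2 x.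
Proof.
move=> U1; apply/eqP; rewrite -(eqrXn2 (n := 2)) ?norm2_ge0 // !sqr_norm2_mx.
by rewrite trmx_mul -mulmxA (mulmxA U^T) U1 mul1mx.
Qed.

(** With [s = x^T y] and [b = |y|^2], expanding [|b x - s y|^2 >= 0] leaves
    [b (|x|^2 b - s^2) >= 0], and [b > 0] cancels. *)
Lemma cauchy_schwarz (R : realType) n (x y : 'cV[R]_n) :
  `|(x^T *m y) 0 0| <= norm2 x * norm2 y.
Proof.
have [->|y0] := eqVneq y 0; first by rewrite mulmx0 mxE normr0 norm20 mulr0.
rewrite -ler_sqr ?nnegrE ?mulr_ge0 ?norm2_ge0 // exprMn real_normK ?num_real //.
set s := (x^T *m y) 0 0; set b := norm2 y ^+ 2.
have b_gt0 : 0 < b by rewrite exprn_gt0 // lt0r norm2_eq0 y0 norm2_ge0.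
have := sqnorm_ge0 (b *: x - s *: y); rewrite -sqr_norm2_mx sqr_norm2.
have -> : \sum_i (b *: x - s *: y) i 0 ^+ 2 = b * (norm2 x ^+ 2 * b - s ^+ 2).
  have sE : s = \sum_i x i 0 * y i 0.
    by rewrite /s mxE; apply: eq_bigr => i _; rewrite mxE.
  transitivity (b ^+ 2 * norm2 x ^+ 2 - 2 * b * s * s + s ^+ 2 * b); last by ring.
  rewrite [X in _ + _ * X](erefl : b = norm2 y ^+ 2) !sqr_norm2.
  rewrite [X in _ * _ * X]sE !mulr_sumr -sumrB -big_split /=.
  by apply: eq_bigr => i _; rewrite !mxE; ring.
by rewrite pmulr_rge0 // subr_ge0.
Qed.

Lemma ler_norm2D (R : realType) n (x y : 'cV[R]_n) :
  norm2 (x + y) <= norm2 x + norm2 y.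
Proof.
rewrite -ler_sqr ?nnegrE ?addr_ge0 ?norm2_ge0 // sqrrD.
have -> : norm2 (x + y) ^+ 2 = norm2 x ^+ 2 + (x^T *m y) 0 0 *+ 2 + norm2 y ^+ 2.
  rewrite !sqr_norm2 [(_ *m _) _ _]mxE -sumrMnl -!big_split /=.
  by apply: eq_bigr => i _; rewrite !mxE sqrrD.
rewrite lerD2r lerD2l ler_pMn2r //.
exact: le_trans (ler_norm _) (cauchy_schwarz x y).
Qed.

Lemma ler_norm2_sum (R : realType) n (I : Type) (r : seq I) (P : pred I)
    (f : I -> 'cV[R]_n) :
  norm2 (\sum_(j <- r | P j) f j) <= \sum_(j <- r | P j) norm2 (f j).
Proof.
elim/big_rec2: _ => [|j b x _ le_xb]; first by rewrite norm20.
by apply: le_trans (ler_norm2D _ _) _; rewrite lerD2l.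
Qed.

(** * Rectangular diagonal matrices in coordinates *)

(* Extension by zero: it lets vectors of sizes [p] and [q] be summed together. *)
Definition pad (R : realType) n (x : 'cV[R]_n) (l : nat) : R :=
  if insub l : option 'I_n is Some i then x i 0 else 0.

Lemma pad_ord (R : realType) n (x : 'cV[R]_n) (i : 'I_n) : pad x i = x i 0.
Proof. by rewrite /pad valK. Qed.

Lemma pad_out (R : realType) n (x : 'cV[R]_n) l : (n <= l)%N -> pad x l = 0.
Proof. by move=> le_nl; rewrite /pad insubN // -leqNgt. Qed.

Lemma padB (R : realType) n (x y : 'cV[R]_n) l : pad (x - y) l = pad x l - pad y l.
Proof. by rewrite /pad; case: insub => [i|]; rewrite ?mxE ?subrr. Qed.

Lemma padZ (R : realType) n a (x : 'cV[R]_n) l : pad (a *: x) l = a * pad x l.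
Proof. by rewrite /pad; case: insub => [i|]; rewrite ?mxE ?mulr0. Qed.

Lemma sqr_norm2_pad (R : realType) n N (x : 'cV[R]_n) : (n <= N)%N ->
  norm2 x ^+ 2 = \sum_(l < N) pad x l ^+ 2.
Proof.
move=> le_nN; rewrite sqr_norm2.
under eq_bigr do rewrite -pad_ord.
rewrite (big_ord_widen N (fun l => pad x l ^+ 2)) // big_mkcond /=.
apply: eq_bigr => l _; case: ltnP => // le_nl.
by rewrite pad_out // expr0n.
Qed.

(** The default [0] past the end of the diagonal stands for the eigenvalue [0] that a non-square
    shape forces on the symmetric block matrix. *)
Definition diag_coef (R : realType) p q (S : 'M[R]_(p, q)) (l : nat) : R :=
  if insub l : option 'I_q is Some j then pad (col j S) l else 0.

Lemma diag_coefE (R : realType) p q (S : 'M[R]_(p, q)) (i : 'I_p) (j : 'I_q) :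
  i = j :> nat -> diag_coef S i = S i j.
Proof. by move=> ij; rewrite {1}/diag_coef {1}ij valK pad_ord mxE. Qed.

Lemma diag_coef_out (R : realType) p q (S : 'M[R]_(p, q)) l :
  (minn p q <= l)%N -> diag_coef S l = 0.
Proof.
rewrite geq_min orbC /diag_coef; case: insubP => // j lt_lq _.
by rewrite leqNgt lt_lq /=; exact: pad_out.
Qed.

Lemma diag_coef_tr (R : realType) p q (S : 'M[R]_(p, q)) l :
  diag_coef S^T l = diag_coef S l.
Proof.
have [lt_l|le_l] := ltnP l (minn p q); last by rewrite !diag_coef_out // minnC.
have [lt_lp lt_lq] : (l < p)%N /\ (l < q)%N by apply/andP; rewrite -ltn_min.
rewrite (diag_coefE _ (i := Ordinal lt_lq) (j := Ordinal lt_lp)) // mxE.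
by rewrite (diag_coefE _ (i := Ordinal lt_lp) (j := Ordinal lt_lq)).
Qed.

Lemma pad_mul_diag (R : realType) p q (S : 'M[R]_(p, q)) (b : 'cV[R]_q) l :
  (forall (i : 'I_p) (j : 'I_q), i != j :> nat -> S i j = 0) ->
  pad (S *m b) l = diag_coef S l * pad b l.
Proof.
move=> S0; have [lt_lp|le_pl] := ltnP l p; last first.
  by rewrite pad_out // diag_coef_out ?mul0r // geq_min le_pl.
rewrite -[l]/(val (Ordinal lt_lp)) pad_ord mxE /=.
have [lt_lq|le_ql] := ltnP l q; last first.
  rewrite diag_coef_out ?geq_min ?le_ql ?orbT // mul0r big1 // => j _.
  by rewrite S0 ?mul0r //= neq_ltn (leq_trans (ltn_ord j)) // orbT.
rewrite (bigD1 (Ordinal lt_lq)) //= big1 ?addr0 => [|j neq_jl]; last first.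
  by rewrite S0 ?mul0r // eq_sym; apply: contraNN neq_jl => /eqP jl; apply/eqP/val_inj.
rewrite -[l]/(val (Ordinal lt_lq)) pad_ord; congr (_ * _) => /=.
by rewrite (diag_coefE _ (i := Ordinal lt_lp) (j := Ordinal lt_lq)).
Qed.

(** * Singular values, singular vectors and residuals *)

Lemma sing_val_svd (R : realType) p q (A : 'M[R]_(p, q)) :
  exists U S V, is_svd A U S V /\
    forall l : 'I_(minn p q), sing_val A l = diag_coef S l.
Proof.
rewrite /sing_val; case: (cid _) => [[[U S] V] svdA]; exists U, S, V; split => // l.
by rewrite (diag_coefE _ (i := widen_ord (geq_minl p q) l)
                         (j := widen_ord (geq_minr p q) l)).
Qed.

(* A lower bound for [t - H], where [H] is the symmetric matrix with off-diagonal
   blocks [A] and [A^T]: its spectrum consists of the [+/- sing_val A l] and,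
   possibly, [0], so [t >= 0] is at distance at least [c] from all of it. *)
Lemma sing_val_lower_bound (R : realType) p q (A : 'M[R]_(p, q)) (t c : R)
    (a : 'cV[R]_p) (b : 'cV[R]_q) :
  0 <= c <= t -> (forall l, c <= `|t - sing_val A l|) ->
  c ^+ 2 * (norm2 a ^+ 2 + norm2 b ^+ 2) <=
    norm2 (A *m b - t *: a) ^+ 2 + norm2 (A^T *m a - t *: b) ^+ 2.
Proof.
move=> /andP[c0 ct]; have [U [S [V [[U1 V1 AE Soff S0] svE]]]] := sing_val_svd A.
(* Passing to [U^T a] and [V^T b] preserves norms and turns [A] into the diagonal [S], so the claim
   splits into one inequality for each index. *)
move=> cE; rewrite {}AE; have UU := mulmx1C U1; have VV := mulmx1C V1.
rewrite -[a]mul1mx -UU -[b]mul1mx -VV -!mulmxA.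
move: (U^T *m a) (V^T *m b) => {}a {}b.
rewrite !trmx_mul trmxK -!mulmxA (mulmxA V^T) V1 (mulmxA U^T) U1 !mul1mx.
rewrite !scalemxAr -!mulmxBr !norm2_orthogonal //.
rewrite !(@sqr_norm2_pad R p (p + q)) ?leq_addr //.
rewrite !(@sqr_norm2_pad R q (p + q)) ?leq_addl //.
rewrite -!big_split mulr_sumr; apply: ler_sum => l _ /=.
rewrite !padB !padZ !pad_mul_diag // => [|i j]; last by rewrite mxE eq_sym; exact: Soff.
rewrite diag_coef_tr; set s := diag_coef S l.
(* Past the diagonal [s = 0], and there the bound is [c <= t]. *)
have [s0 cs] : 0 <= s /\ c <= `|t - s|.
  rewrite /s; have [lt_l|le_l] := ltnP l (minn p q).
    rewrite -[nat_of_ord l]/(val (Ordinal lt_l)) -svE; split=> //.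
    rewrite svE (diag_coefE _ (i := widen_ord (geq_minl p q) (Ordinal lt_l))
                         (j := widen_ord (geq_minr p q) (Ordinal lt_l))) //.
    exact: S0.
  by rewrite diag_coef_out // subr0 ger0_norm // (le_trans c0).
move: (pad a l) (pad b l) => x y.
have cs2 : c ^+ 2 <= (t - s) ^+ 2.
  by rewrite -[leRHS]real_normK ?num_real // ler_sqr ?nnegrE ?(le_trans c0).
apply: (@le_trans _ _ ((t - s) ^+ 2 * (x ^+ 2 + y ^+ 2))).
  by rewrite ler_wpM2r // addr_ge0 ?sqr_ge0.
(* The eigenvalues on this plane are [s] and [- s]; since [s] and [t] are nonnegative, [- s] is no
   closer to [t] than [s]. *)
rewrite -subr_ge0.
have -> : (s * y - t * x) ^+ 2 + (s * x - t * y) ^+ 2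
        - (t - s) ^+ 2 * (x ^+ 2 + y ^+ 2) = 2 * (s * t * (x - y) ^+ 2) by ring.
by rewrite mulr_ge0 ?ler0n // mulr_ge0 ?sqr_ge0 // mulr_ge0 // (le_trans c0).
Qed.

(** The columns of [U] and [V] with index [l] serve as [u] and [v]. *)
Lemma sing_vec_exists (R : realType) p q (A : 'M[R]_(p, q)) (l : 'I_(minn p q)) :
  exists (u : 'cV_p) (v : 'cV_q),
    [/\ u != 0, A *m v = sing_val A l *: u & A^T *m u = sing_val A l *: v].
Proof.
have [U [S [V [[U1 V1 AE Soff S0] svE]]]] := sing_val_svd A.
pose i := widen_ord (geq_minl p q) l; pose j := widen_ord (geq_minr p q) l.
have svij : sing_val A l = S i j by rewrite svE -(diag_coefE _ (i := i)).
exists (U *m delta_mx i 0), (V *m delta_mx j 0); split.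
- rewrite -norm2_eq0 norm2_orthogonal // norm2_eq0.
  by apply/eqP => /matrixP /(_ i 0) /eqP; rewrite !mxE !eqxx oner_eq0.
- rewrite {1}AE -!mulmxA (mulmxA V^T) V1 mul1mx scalemxAr; congr (_ *m _).
  rewrite svij -colE; apply/colP => i'; rewrite !mxE eqxx andbT.
  have [->|ne] := eqVneq i' i; first by rewrite mulr1.
  by rewrite mulr0 Soff.
- rewrite {1}AE !trmx_mul trmxK -!mulmxA (mulmxA U^T) U1 mul1mx scalemxAr; congr (_ *m _).
  rewrite svij -colE; apply/colP => j'; rewrite !mxE eqxx andbT.
  have [->|ne] := eqVneq j' j; first by rewrite mulr1.
  by rewrite mulr0 Soff // eq_sym.
Qed.

(** Otherwise the least of [t] and all the distances exceeds [r], and [sing_val_lower_bound] with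
    this constant contradicts the residual bound. *)
Lemma sing_val_near (R : realType) p q (A : 'M[R]_(p, q)) (t r : R)
    (a : 'cV[R]_p) (b : 'cV[R]_q) :
  0 <= r < t -> a != 0 ->
  norm2 (A *m b - t *: a) ^+ 2 + norm2 (A^T *m a - t *: b) ^+ 2 <=
    r ^+ 2 * (norm2 a ^+ 2 + norm2 b ^+ 2) ->
  exists l, `|t - sing_val A l| <= r.
Proof.
move=> /andP[r0 rt] a0 le_r.
have [/existsP//|/existsPn far] := boolP [exists l, `|t - sing_val A l| <= r].
pose c := \big[Num.min/t]_l `|t - sing_val A l|.
have rc : r < c by apply: lt_bigmin => // l _; rewrite ltNge far.
have c0 : 0 <= c := le_trans r0 (ltW rc).
have := @sing_val_lower_bound _ _ _ A t c a b.
rewrite c0 bigmin_le_id => /(_ isT (fun l => bigmin_le _ _ _)) /le_trans /(_ le_r).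
rewrite ler_pM2r; last first.
  by rewrite ltr_pwDl ?sqr_ge0 // exprn_gt0 // lt0r norm2_eq0 a0 norm2_ge0.
by rewrite ler_sqr ?nnegrE // leNgt rc.
Qed.

(* The two nested minima in delta are folded into one: the minimum over the
   singular values of A2 starts from the value |theta_i|, so that it equals
   |theta_i| when A2 has no singular values. *)
Theorem theorem3 (R : realType) (m n k : nat)
    (hmn : m <> n) (hk : (1 <= k <= minn m n)%N)
    (theta : 'rV[R]_k) (theta_ge0 : forall j : 'I_k, 0 <= theta 0 j)
    (E : 'M[R]_(n - k, k)) (F : 'M[R]_(m - k, k)) (A2 : 'M[R]_(m - k, n - k))
    (i : 'I_k) :
  let A : 'M[R]_(k + (m - k), k + (n - k)) :=
    block_mx (diag_mx theta) E^T F A2 in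
  let sq (j : 'I_k) : R := norm2 (col j E) ^+ 2 + norm2 (col j F) ^+ 2 in
  let delta : R :=
    \big[Num.min/`|theta 0 i|]_(j < minn (m - k) (n - k))
        `|theta 0 i - sing_val A2 j|
    - Num.sqrt (sq i / 2) in
  let delta_ (j : 'I_k) : R :=
    `|theta 0 i - theta 0 j| - Num.sqrt (sq i / 2) in
  let delta'_ (j : 'I_k) : R :=
    `|theta 0 i + theta 0 j| - Num.sqrt (sq i / 2) in
  let d : R :=
    1 / (delta - \sum_(j < k | j != i) sq j / (2 * delta_ j)
               - \sum_(j < k) sq j / (2 * delta'_ j)) in
  0 < delta ->
  (forall j : 'I_k, j != i -> 0 < delta_ j) ->
  (forall j : 'I_k, 0 < delta'_ j) ->
  0 < d ->
  exists l : 'I_(minn (k + (m - k)) (k + (n - k))),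
    `|sing_val A l - theta 0 i| <= d * (sq i / 2).
Proof.
move: E F A2; move: (m - k)%N (n - k)%N => p q E F A2 A sq delta delta_ delta'_ d.
set rho := Num.sqrt (sq i / 2) in delta delta_ delta'_ d *.
move=> delta_gt0 delta_gt0_ delta_gt0' d_gt0.
have sq_ge0 j : 0 <= sq j by rewrite addr_ge0 ?sqr_ge0.
have rho0 : 0 <= rho by exact: sqrtr_ge0.
have rho2 : rho ^+ 2 = sq i / 2 by rewrite sqr_sqrtr // divr_ge0.
have rho_delta_theta : rho + delta <= theta 0 i.
  by rewrite addrC subrK; apply: le_trans (bigmin_le_id _ _ _ _) _; rewrite ger0_norm.
have rho_delta_sv j : rho + delta <= `|theta 0 i - sing_val A2 j|.
  by rewrite addrC subrK; exact: bigmin_le.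
have AT : A^T = block_mx (diag_mx theta) F^T E A2^T.
  by rewrite tr_block_mx tr_diag_mx trmxK.
(* The test vector has squared norm [2]; its residual consists of [F_i] and [E_i], of squared norm
   [sq i = 2 * rho ^+ 2]. *)
have [|||l near] := @sing_val_near _ _ _ A (theta 0 i) rho
    (col_mx (delta_mx i 0) 0) (col_mx (delta_mx i 0) 0).
- by rewrite rho0 (lt_le_trans _ rho_delta_theta) // ltrDl.
- rewrite col_mx_eq0 negb_and; apply/orP; left.
  by apply/eqP => /matrixP /(_ i 0) /eqP; rewrite !mxE !eqxx oner_eq0.
- have diag_e : diag_mx theta *m delta_mx i 0 = theta 0 i *: delta_mx i 0 :> 'cV_k.
    apply/colP => j; rewrite mul_diag_mx !mxE eqxx andbT.
    by have [->|] := eqVneq; rewrite ?mulr0.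
  have e1 : norm2 (delta_mx i 0 : 'cV[R]_k) ^+ 2 = 1.
    by rewrite sqr_norm2_mx trmx_delta mul_delta_mx mxE !eqxx.
  rewrite AT !mul_block_col !mulmx0 !addr0 diag_e -!colE !scale_col_mx !scaler0.
  rewrite !opp_col_mx !add_col_mx !subrr !oppr0 !addr0 !sqr_norm2_col_mx !norm20 e1.
  by rewrite expr0n !add0r !addr0 rho2 mulrDr mulr1 -splitr addrC.
exists l; set lam := sing_val A l in near *.
have lam_ge_delta : delta <= lam.
  by move: near; rewrite ler_norml => /andP[_ near]; lra.
(* The [rho] subtracted in each gap pays for replacing [theta 0 i] by [lam]. *)
have lam_gap j : delta_ j <= `|lam - theta 0 j|.
  rewrite lerBlDr; apply: le_trans (ler_distD lam _ _) _.
  by rewrite addrC lerD2l.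
have lam_gap' j : delta'_ j <= lam + theta 0 j.
  rewrite lerBlDr ger0_norm ?addr_ge0 //.
  by move: near; rewrite ler_norml => /andP[_ near]; lra.
have lam_gap2 j : delta <= `|lam - sing_val A2 j|.
  have dist := ler_distD lam (theta 0 i) (sing_val A2 j).
  by have gap := rho_delta_sv j; lra.
(* In the basis [(e_j, +/- e_j)] the singular vector equations [A v = lam u],
   [A^T u = lam v] diagonalise their first block; [P j] and [Q j] are the
   coordinates (up to a factor), [c 1 j] and [c (-1) j] the coupling vectors. *)
have [u [v []]] := sing_vec_exists A l.
rewrite -/lam AT -[u]vsubmxK -[v]vsubmxK.
move: (usubmx u) (dsubmx u) (usubmx v) (dsubmx v) => {u v} u1 u2 v1 v2 uv0.
rewrite !mul_block_col !scale_col_mx => /eq_col_mx [eqT1 eqT2] /eq_col_mx [eqB1 eqB2].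
pose w := col_mx u2 v2.
pose c (s : R) j := col_mx (col j F) (s *: col j E).
pose N j := Num.sqrt (sq j).
have N_ge0 j : 0 <= N j by exact: sqrtr_ge0.
have N2 j : N j ^+ 2 = sq j by rewrite sqr_sqrtr.
have normc s j : `|s| = 1 -> norm2 (c s j) = N j.
  move=> s1; apply/eqP; rewrite -(eqrXn2 (n := 2)) ?norm2_ge0 // N2.
  by rewrite sqr_norm2_col_mx norm2Z s1 mul1r addrC.
pose W := norm2 w.
have W0 : 0 <= W by exact: norm2_ge0.
have cw s j : ((c s j)^T *m w) 0 0 = (F^T *m u2) j 0 + s * (E^T *m v2) j 0.
  rewrite tr_col_mx mul_row_col mxE linearZ /= -scalemxAl [in X in _ + X]mxE.
  by congr (_ + _ * _); rewrite !mxE; apply: eq_bigr => l' _; rewrite !mxE.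
pose P j := u1 j 0 + v1 j 0; pose Q j := u1 j 0 - v1 j 0.
have eqT j : theta 0 j * v1 j 0 + (E^T *m v2) j 0 = lam * u1 j 0.
  by have /colP /(_ j) := eqT1; rewrite mul_diag_mx 4!mxE.
have eqB j : theta 0 j * u1 j 0 + (F^T *m u2) j 0 = lam * v1 j 0.
  by have /colP /(_ j) := eqB1; rewrite mul_diag_mx 4!mxE.
(* The sum of [eqT] and [eqB] gives [PE], their difference [QE]. *)
have PE j : (lam - theta 0 j) * P j = ((c 1 j)^T *m w) 0 0.
  rewrite cw mulrBl !mulrDr -eqT -eqB; ring.
have QE j : (lam + theta 0 j) * Q j = - ((c (-1) j)^T *m w) 0 0.
  rewrite cw mulrDl !mulrBr -eqT -eqB; ring.
have Ple j : `|lam - theta 0 j| * `|P j| <= N j * W.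
  by rewrite -normrM PE -(normc 1) ?normr1 //; exact: cauchy_schwarz.
have Qle j : (lam + theta 0 j) * `|Q j| <= N j * W.
  have lt0 : 0 <= lam + theta 0 j := le_trans (ltW (delta_gt0' j)) (lam_gap' j).
  rewrite -{1}(ger0_norm lt0) -normrM QE normrN -(normc (-1)) ?normrN1 //.
  exact: cauchy_schwarz.
(* One factor [N j] comes from solving for [P j], the other from the norm of [c 1 j] when [P j] is
   substituted into [z] below. *)
have Pterm j : j != i -> `|P j| / 2 * N j <= W * (sq j / (2 * delta_ j)).
  move=> ne; have dj := delta_gt0_ j ne.
  have Pj : `|P j| <= N j * W / delta_ j.
    rewrite ler_pdivlMr // mulrC; apply: le_trans (Ple j).
    by rewrite ler_wpM2r // lam_gap.
  apply: (@le_trans _ _ (N j * W / delta_ j / 2 * N j)).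
    by rewrite ler_wpM2r // ler_wpM2r // invr_ge0.
  by rewrite -N2 le_eqVlt; apply/orP; left; apply/eqP; field; rewrite gt_eqF.
have Qterm j : `|Q j| / 2 * N j <= W * (sq j / (2 * delta'_ j)).
  have dj := delta_gt0' j.
  have Qj : `|Q j| <= N j * W / delta'_ j.
    rewrite ler_pdivlMr // mulrC; apply: le_trans (Qle j).
    by rewrite ler_wpM2r // lam_gap'.
  apply: (@le_trans _ _ (N j * W / delta'_ j / 2 * N j)).
    by rewrite ler_wpM2r // ler_wpM2r // invr_ge0.
  by rewrite -N2 le_eqVlt; apply/orP; left; apply/eqP; field; rewrite gt_eqF.
pose z := col_mx (F *m v1) (E *m u1).
have cu s j y : c s j (lshift q y) 0 = F y j by rewrite col_mxEu mxE.
have cd s j y : c s j (rshift p y) 0 = s * E y j by rewrite col_mxEd !mxE.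
(* Substitute [u1 = (P + Q) / 2] and [v1 = (P - Q) / 2]. *)
have zE : z = \sum_j (P j / 2) *: c 1 j + \sum_j (- (Q j / 2)) *: c (-1) j.
  rewrite -big_split /z; apply/colP => x; rewrite summxE -(splitK x).
  case: (split x) => y /=; rewrite ?col_mxEu ?col_mxEd mxE; apply: eq_bigr => j _;
    rewrite [RHS]mxE ![fun_of_matrix (_ *: _) _ _]mxE ?cu ?cd /P /Q; by field.
(* [z] is also [(lam - B) w], [B] having off-diagonal blocks [A2] and [A2^T]. *)
have delta_W : delta * W <= norm2 z.
  rewrite -ler_sqr ?nnegrE ?norm2_ge0 ?mulr_ge0 ?(ltW delta_gt0) //.
  rewrite exprMn !sqr_norm2_col_mx.
  have := @sing_val_lower_bound _ _ _ A2 lam delta u2 v2.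
  rewrite lam_ge_delta (ltW delta_gt0) => /(_ isT lam_gap2) /le_trans; apply.
  have normB r : forall x y : 'cV[R]_r, norm2 (y - (x + y)) = norm2 x.
    by move=> x y; rewrite opprD addrCA subrr addr0 norm2N.
  by rewrite -eqT2 -eqB2 !normB.
have norm_z : norm2 z <= `|P i| / 2 * N i
    + (\sum_(j | j != i) `|P j| / 2 * N j + \sum_j `|Q j| / 2 * N j).
  have sumP : \sum_j `|P j| / 2 * N j =
      `|P i| / 2 * N i + \sum_(j | j != i) `|P j| / 2 * N j by rewrite (bigD1 i).
  rewrite [leRHS]addrA -sumP zE; apply: le_trans (ler_norm2D _ _) _.
  have h2 (x : R) : `|x / 2| = `|x| / 2 by rewrite normrM (@ger0_norm _ 2^-1) ?invr_ge0.
  apply: lerD; apply: le_trans (ler_norm2_sum _ _ _) _; apply: ler_sum => j _.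
    by rewrite norm2Z normc ?normr1 // h2.
  by rewrite norm2Z normc ?normrN1 // normrN h2.
pose D := d^-1.
have D_gt0 : 0 < D by rewrite invr_gt0.
(* Only [P i] is kept, its gap [lam - theta 0 i] being the quantity to estimate; the other terms are
   absorbed on the left, which turns [delta] into [1 / d]. *)
have DW : D * W <= `|P i| / 2 * N i.
  rewrite /D /d div1r invrK 2!mulrBl.
  rewrite 2!lerBlDr -addrA; apply: le_trans delta_W (le_trans norm_z _).
  rewrite lerD2l addrC; apply: lerD; rewrite mulrC mulr_sumr; apply: ler_sum => j.
    exact: Pterm.
  by move=> _; exact: Qterm.
(* If [P i = 0], then [DW] forces [w = 0], the gaps force every [P j] and [Q j] to vanish, and so
   the left singular vector is zero. *)
have Pi_gt0 : 0 < `|P i|.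
  rewrite normr_gt0; apply: contraNneq uv0 => Pi0.
  have W00 : W = 0.
    apply/eqP; rewrite eq_le W0 andbT -(ler_pM2l D_gt0) mulr0.
    by rewrite (le_trans DW) // Pi0 normr0 !mul0r.
  have PQ0 j : P j = 0 /\ Q j = 0.
    split; last first.
      have := Qle j; rewrite W00 mulr0 pmulr_rle0 ?normr_le0 => [/eqP //|].
      exact: lt_le_trans (delta_gt0' j) (lam_gap' j).
    have [->//|ne] := eqVneq j i.
    have := Ple j; rewrite W00 mulr0 pmulr_rle0 ?normr_le0 => [/eqP //|].
    exact: lt_le_trans (delta_gt0_ j ne) (lam_gap j).
  have : w == 0 by rewrite -norm2_eq0 -/W W00.
  rewrite /w col_mx_eq0 => /andP[/eqP -> _].
  rewrite col_mx_eq0 eqxx andbT; apply/eqP/colP => j; rewrite mxE.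
  by have [P0 Q0] := PQ0 j; rewrite /P /Q in P0 Q0; lra.
(* Chaining [Ple i] with [DW] eliminates [W] and produces [N i] twice; then [P i] cancels. *)
rewrite -(ler_pM2l D_gt0) [leRHS]mulKf ?gt_eqF // -(ler_pM2r Pi_gt0) -mulrA.
apply: (@le_trans _ _ (D * (N i * W))); first by rewrite ler_pM2l.
rewrite mulrCA; apply: le_trans (ler_wpM2l (N_ge0 i) DW) _.
by rewrite -N2 le_eqVlt; apply/orP; left; apply/eqP; field.
Qed.
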